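(* Let $A=\sigma(R)\langle x_1,\dots,x_n\rangle$ be a skew PBW extension over a ring $R$, with associated family of endomorphisms $\Sigma$ of $R$, and suppose that $R$ is $\Sigma$-semicommutative and Baer. Then the following statements are equivalent: (1) $W(f)$ is closed in $\mathrm{Spec}(A)$ for each $f\in A$. (2) $\mathrm{Spec}(A)$ is completely regular and Hausdorff. (3) $\mathrm{Spec}(A)$ is $T_1$.
   Context: Rings are associative with identity; $\mathbb{N}$ includes $0$. Skew PBW extension: $A=\sigma(R)\langle x_1,\dots,x_n\rangle$ is a skew PBW extension over $R$ if (i) $R$ is a subring of $A$ with the same identity; (ii) there are $x_1,\dots,x_n\in A$ such that $A$ is a free left $R$-module with basis $\mathrm{Mon}(A):=\{x^\alpha:=x_1^{\alpha_1}\cdots x_n^{\alpha_n}\mid \alpha=(\alpha_1,\dots,\alpha_n)\in\mathbb{N}^n\}$; (iii) for each $i$ and each $r\in R\setminus\{0\}$ there is $c_{i,r}\in R\setminus\{0\}$ with $x_ir-c_{i,r}x_i\in R$; (iv) for all $1\le i,j\le n$ there is $d_{i,j}\in R\setminus\{0\}$ with $x_jx_i-d_{i,j}x_ix_j\in R+Rx_1+\cdots+Rx_n$. For such $A$, for each $i$ there are an injective ring endomorphism $\sigma_i$ of $R$ and a $\sigma_i$-derivation $\delta_i$ of $R$ (an additive map with $\delta_i(rs)=\sigma_i(r)\delta_i(s)+\delta_i(r)s$) such that $x_ir=\sigma_i(r)x_i+\delta_i(r)$ for all $r\in R$. Put $\Sigma:=\{\sigma_1,\dots,\sigma_n\}$,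 and for $\alpha\in\mathbb{N}^n$, $\sigma^\alpha:=\sigma_1^{\alpha_1}\circ\cdots\circ\sigma_n^{\alpha_n}$. $R$ is $\Sigma$-semicommutative if for all $a,b\in R$, $ab=0$ implies $aR\sigma^\alpha(b)=0$ for every $\alpha\in\mathbb{N}^n\setminus\{0\}$. A ring is Baer if the right (equivalently, left) annihilator of every nonempty subset is generated, as a right (respectively left) ideal, by an idempotent. $\mathrm{Spec}(A)$ is the set of all (two-sided) prime ideals of $A$. For a subset $S\subseteq A$, $W(S):=\{P\in\mathrm{Spec}(A)\mid S\nsubseteq P\}$, and $W(f):=W(\{f\})$. $\mathrm{Spec}(A)$ carries the Zariski topology, whose open sets are the $W(I)$ with $I$ an ideal of $A$. *)

(* Defs.v *)
From HB Require Import structures.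
From mathcomp Require Import all_boot all_order all_algebra.
From mathcomp Require Import all_classical all_reals all_analysis.

Set Implicit Arguments.
Unset Strict Implicit.
Unset Printing Implicit Defensive.

Import GRing.Theory.

Local Open Scope classical_set_scope.
Local Open Scope ring_scope.

Definition multi_index (n : nat) := {ffun 'I_n -> nat}.

Definition multi0 (n : nat) : multi_index n := [ffun => 0%N].

(* The big product over 'I_n is taken in increasing order of the index, which
   matters since A is not commutative. *)
Definition monomial (A : pzRingType) (n : nat) (x : 'I_n -> A)
    (alpha : multi_index n) : A :=
  \prod_(i < n) x i ^+ alpha i.

(* R is seen as a subring of A through the injective unital morphism iota.
   The basis condition is about the family of monomials indexed by N^n, so that
   distinct exponents give distinct elements of the basis. *)
Record is_skew_PBW (R A : pzRingType) (iota : {rmorphism R -> A}) (n : nat)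
    (x : 'I_n -> A) : Prop := SkewPBW {
  skew_PBW_subring : injective iota ;
  skew_PBW_span : forall a : A,
    exists (s : seq (multi_index n)) (c : multi_index n -> R),
      a = \sum_(alpha <- s) iota (c alpha) * monomial x alpha ;
  skew_PBW_free : forall (s : seq (multi_index n)) (c : multi_index n -> R),
    uniq s -> \sum_(alpha <- s) iota (c alpha) * monomial x alpha = 0 ->
    forall alpha, alpha \in s -> c alpha = 0 ;
  skew_PBW_coef : forall (i : 'I_n) (r : R), r <> 0 ->
    exists2 c : R, c <> 0 &
      exists d : R, x i * iota r - iota c * x i = iota d ;
  skew_PBW_comm : forall i j : 'I_n,
    exists2 d : R, d <> 0 &
      exists (r0 : R) (r : 'I_n -> R),
        x j * x i - iota d * x i * x j
        = iota r0 + \sum_(k < n) iota (r k) * x k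
}.

(* These data exist and are unique for every skew PBW extension: see
   skew_PBW_associated_exists and skew_PBW_associated_unique. *)
Definition skew_PBW_associated (R A : pzRingType) (iota : {rmorphism R -> A})
    (n : nat) (x : 'I_n -> A) (sigma : 'I_n -> {rmorphism R -> R})
    (delta : 'I_n -> {additive R -> R}) : Prop :=
  forall i : 'I_n,
    [/\ injective (sigma i),
        forall r s : R, delta i (r * s) = sigma i r * delta i s + delta i r * s
      & forall r : R, x i * iota r = iota (sigma i r) * x i + iota (delta i r)].

Definition sigma_pow (R : pzRingType) (n : nat)
    (sigma : 'I_n -> {rmorphism R -> R}) (alpha : multi_index n) : R -> R :=
  \big[(fun f g : R -> R => f \o g)/idfun]_(i < n) iter (alpha i) (sigma i).

Definition Sigma_semicommutative (R : pzRingType) (n : nat)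
    (sigma : 'I_n -> {rmorphism R -> R}) : Prop :=
  forall a b : R, a * b = 0 ->
  forall alpha : multi_index n, alpha <> multi0 n ->
  forall r : R, a * r * sigma_pow sigma alpha b = 0.

Definition right_annihilator (R : pzRingType) (S : set R) : set R :=
  [set r | forall s, S s -> s * r = 0].

Definition Baer (R : pzRingType) : Prop :=
  forall S : set R, S !=set0 ->
  exists2 e : R, e * e = e & right_annihilator S = [set e * t | t in [set: R]].

Record is_ideal (A : pzRingType) (I : set A) : Prop := IsIdeal {
  ideal0 : I 0 ;
  idealD : forall a b, I a -> I b -> I (a + b) ;
  idealMl : forall a b, I b -> I (a * b) ;
  idealMr : forall a b, I a -> I (a * b)
}.

(* The product ideal I J consists of the finite sums of products a * b, so for
   an ideal P the inclusion of I J in P amounts to that of these products. *)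
Record is_prime_ideal (A : pzRingType) (P : set A) : Prop := IsPrimeIdeal {
  prime_ideal : is_ideal P ;
  prime_proper : P <> [set: A] ;
  prime_mul : forall I J : set A, is_ideal I -> is_ideal J ->
    (forall a b, I a -> J b -> P (a * b)) -> I `<=` P \/ J `<=` P
}.

Record Spec (A : pzRingType) := MkSpec {
  spec_set : set A ;
  spec_prime : is_prime_ideal spec_set
}.

HB.instance Definition _ (A : pzRingType) := gen_eqMixin (Spec A).
HB.instance Definition _ (A : pzRingType) := gen_choiceMixin (Spec A).

Definition specW (A : pzRingType) (S : set A) : set (Spec A) :=
  [set P | ~ S `<=` spec_set P].

Section Zariski.
Variable A : pzRingType.

Definition zariski_open : set_system (Spec A) :=
  [set U | exists2 I : set A, is_ideal I & U = specW I].

Lemma zariski_openT : zariski_open setT.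
Proof.
exists [set: A]; first by split.
apply/seteqP; split=> // P _ /= PT; have [_ + _] := spec_prime P.
by apply; apply/seteqP; split.
Qed.

Lemma zariski_openI : setI_closed zariski_open.
Proof.
move=> _ _ [I idI ->] [J idJ ->]; exists (I `&` J).
  split=> [|a b [Ia Ja] [Ib Jb]|a b [Ib Jb]|a b [Ia Ja]].
  - by split; apply: ideal0.
  - by split; apply: idealD.
  - by split; apply: idealMl.
  - by split; apply: idealMr.
apply/seteqP; split=> P /=.
  move=> [nI nJ] IJP; have [] := prime_mul (spec_prime P) idI idJ.
  - by move=> a b Ia Jb; apply: IJP; split; [apply: idealMr|apply: idealMl].
  - exact: nI.
  - exact: nJ.
by move=> nIJ; split=> sub; apply: nIJ => a [Ia Ja]; apply: sub.
Qed.

Lemma zariski_open_bigU (T : Type) (f : T -> set (Spec A)) :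
  (forall i, zariski_open (f i)) -> zariski_open (\bigcup_i f i).
Proof.
move=> of_.
pose K := [set a : A | forall I : set A, is_ideal I ->
  (forall i J, is_ideal J -> f i = specW J -> J `<=` I) -> I a].
exists K.
  split=> [I idI _|a b Ka Kb I idI h|a b Kb I idI h|a b Ka I idI h].
  - exact: ideal0.
  - by apply: idealD => //; [apply: Ka|apply: Kb].
  - by apply: idealMl => //; apply: Kb.
  - by apply: idealMr => //; apply: Ka.
apply/seteqP; split=> P /=.
  move=> [i _]; have [J idJ fJ] := of_ i; rewrite fJ /= => nJP KP.
  apply: nJP => a Ja; apply: KP => I idI h; exact: (h i J idJ fJ).
move=> nKP; apply: contrapT => nf; apply: nKP => a; apply.
  exact: prime_ideal (spec_prime P).
move=> i J idJ fJ; apply: contrapT => nJP; apply: nf; exists i => //.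
by rewrite fJ.
Qed.

HB.instance Definition _ := isOpenTopological.Build (Spec A)
  zariski_openT zariski_openI zariski_open_bigU.

Lemma open_specE (U : set (Spec A)) : open U = zariski_open U.
Proof. by []. Qed.

End Zariski.

Section Associated.
Variables (R A : pzRingType) (iota : {rmorphism R -> A}) (n : nat).
Variables (x : 'I_n -> A) (pbw : is_skew_PBW iota x).

Let multi1 (i : 'I_n) : multi_index n := [ffun j => (j == i) : nat].

Let monomial0 : monomial x (multi0 n) = 1.
Proof. by rewrite /monomial big1 // => i _; rewrite ffunE expr0. Qed.

Let monomial1 i : monomial x (multi1 i) = x i.
Proof.
rewrite /monomial (eq_bigr (fun j => if j == i then x j else 1)).
  by rewrite -big_mkcond big_pred1_eq.
by move=> j _; rewrite ffunE; case: eqP => _; rewrite ?expr1 ?expr0.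
Qed.

Let affine_inj i (a b c d : R) :
  iota a * x i + iota b = iota c * x i + iota d -> a = c /\ b = d.
Proof.
move=> /eqP; rewrite -subr_eq0 opprD addrACA -mulrBl -!rmorphB => /eqP e.
have n01 : multi0 n != multi1 i.
  by apply/eqP => /ffunP /(_ i); rewrite !ffunE eqxx.
pose g (al : multi_index n) := if al == multi0 n then b - d else a - c.
have := @skew_PBW_free _ _ _ _ _ pbw [:: multi1 i; multi0 n] g.
rewrite /= inE eq_sym n01 => /(_ isT).
rewrite big_cons big_seq1 monomial0 monomial1 mulr1 /g eqxx (eq_sym (multi1 i)).
rewrite (negPf n01) => /(_ e) h; split; apply/eqP; rewrite -subr_eq0; apply/eqP.
  by have := h (multi1 i); rewrite inE eqxx eq_sym (negPf n01); apply.
by have := h (multi0 n); rewrite !inE eqxx orbT; apply.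
Qed.

Lemma skew_PBW_associated_exists :
  exists (sigma : 'I_n -> {rmorphism R -> R}) (delta : 'I_n -> {additive R -> R}),
    skew_PBW_associated iota x sigma delta.
Proof.
have H i : exists sd : {rmorphism R -> R} * {additive R -> R},
    [/\ injective sd.1,
        forall r s : R, sd.2 (r * s) = sd.1 r * sd.2 s + sd.2 r * s
      & forall r : R, x i * iota r = iota (sd.1 r) * x i + iota (sd.2 r)].
  have E r : exists cd : R * R, (r <> 0 -> cd.1 <> 0) /\
      x i * iota r = iota cd.1 * x i + iota cd.2.
    have [->|/eqP r0] := eqVneq r 0.
      by exists (0, 0); split=> //=; rewrite !rmorph0 mulr0 mul0r addr0.
    have [c c0 [d e]] := skew_PBW_coef pbw i r0.
    by exists (c, d); split=> //=; rewrite -e addrC subrK.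
  have [f fP] := choice E.
  pose s r := (f r).1; pose d r := (f r).2.
  have fE r : x i * iota r = iota (s r) * x i + iota (d r) by case: (fP r).
  have s0 r : s r = 0 -> r = 0.
    by move=> sr; apply: contrapT => /(proj1 (fP r)).
  have sdB a b : s (a - b) = s a - s b /\ d (a - b) = d a - d b.
    apply: (@affine_inj i); rewrite -fE !rmorphB mulrBr !fE mulrBl.
    by rewrite opprD addrACA.
  have sdM a b : s (a * b) = s a * s b /\ d (a * b) = s a * d b + d a * b.
    apply: (@affine_inj i); rewrite -fE rmorphM mulrA fE mulrDl -mulrA fE.
    by rewrite rmorphD !rmorphM mulrDr !mulrA addrA.
  have s1 : s 1 = 1.
    have [] := @affine_inj i (s 1) (d 1) 1 0; last by [].
    by rewrite -fE !rmorph1 mulr1 mul1r rmorph0 addr0.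
  have sB : zmod_morphism s by move=> a b; case: (sdB a b).
  have dB : zmod_morphism d by move=> a b; case: (sdB a b).
  have sM : monoid_morphism s by split=> // a b; case: (sdM a b).
  pose sa := GRing.isZmodMorphism.Build R R s sB.
  pose sm := GRing.isMonoidMorphism.Build R R s sM.
  pose da := GRing.isZmodMorphism.Build R R d dB.
  pose sr : {rmorphism R -> R} := HB.pack s sa sm.
  pose dr : {additive R -> R} := HB.pack d da.
  exists (sr, dr); split=> //=; last by move=> a b; case: (sdM a b).
  move=> a b /= e; apply/eqP; rewrite -subr_eq0; apply/eqP; apply: s0.
  by rewrite sB e subrr.
have [f fP] := choice H.
by exists (fun i => (f i).1), (fun i => (f i).2).
Qed.

Lemma skew_PBW_associated_unique sigma delta sigma' delta' :
  skew_PBW_associated iota x sigma delta ->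
  skew_PBW_associated iota x sigma' delta' ->
  forall i r, sigma i r = sigma' i r /\ delta i r = delta' i r.
Proof.
move=> h h' i r; case: (h i) => _ _ e; case: (h' i) => _ _ e'.
by apply: (@affine_inj i); rewrite -e -e'.
Qed.

End Associated.

(* Main.v *)
Require Import Defs.
From HB Require Import structures.
From mathcomp Require Import all_boot all_order all_algebra.
From mathcomp Require Import all_classical all_reals all_analysis.
From mathcomp Require Import zify.

Set Implicit Arguments.
Unset Strict Implicit.
Unset Printing Implicit Defensive.

Import GRing.Theory.

Local Open Scope classical_set_scope.
Local Open Scope ring_scope.

(** The theorem holds because A is reduced: a * a = 0 forces a = 0.

    Why A is reduced.  Let e be an idempotent of R.  Applying
    Sigma-semicommutativity to e (1 - e) = 0 and to (1 - e) e = 0 gives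
    e r = e r sigma_i(e) = r sigma_i(e) for all r; hence sigma_i(e) = e and e is
    central ([semicommutative_idem]).  In a Baer ring every right annihilator
    is e R with e idempotent, and centrality of e makes R reduced, while
    sigma_i(e) = e makes each sigma_i reflect zero products: a sigma_i(b) = 0
    implies a b = 0.  Both facts pass to A through leading terms.  Modulo
    monomials of degree less than |al| + |be|, the product x^al r x^be is
    tau(r) u x^(al + be), where tau is a composite of the sigma_i and u is
    invertible ([monomial_mul_lead]).  If f * f = 0 with f supported on s, take
    al in s of maximal degree and, among those, of maximal sum of squares of
    exponents.  By the parallelogram law al + al is a sum of two elements of s
    in only one way ([madd_extremal]), so the coefficient of x^(al + al) in
    f * f is c tau(c) u with c the coefficient of x^al in f.  Hence
    c tau(c) = 0, then c * c = 0 and c = 0; f vanishes by induction on s.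

    Why the three statements are then equivalent.  The sets W(f) form a basis
    of the topology and separate points, so if they are clopen then Spec(A) is
    Hausdorff and completely regular; Hausdorff spaces are T1.  If Spec(A) is
    T1, there is no strict inclusion between primes.  In a reduced ring, every
    element f of a prime P that contains no smaller prime is killed by some
    s outside P ([minimal_prime_ann]): otherwise the multiplicative set
    generated by f and the complement of P would avoid 0, and a prime avoiding
    it would lie strictly inside P.  Conversely s f = 0 implies s A f = 0, so
    any prime missing s contains f.  Thus the complement of W(f) is W(I), where
    I is the annihilator of f, and W(f) is closed. *)

(** * Reduced rings *)

Section Reduced.
Variable A : pzRingType.

Definition reduced := forall a : A, a * a = 0 -> a = 0.

Hypothesis red : reduced.

Lemma reduced_mul_swap (a b : A) : a * b = 0 -> b * a = 0.
Proof.
move=> ab0; apply: red.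
by rewrite mulrA -(mulrA b a b) ab0 mulr0 mul0r.
Qed.

Lemma reduced_mul_insert (a b r : A) : a * b = 0 -> a * r * b = 0.
Proof.
move=> /reduced_mul_swap ba0; apply: red.
by rewrite -!mulrA (mulrA b a) ba0 mul0r !mulr0.
Qed.

(** In a reduced ring a vanishing product stays zero under insertion of
    factors, and a repeated factor may be kept only once: the square of
    c r c' f t is the product c f c' f t with further factors inserted. *)
Lemma reduced_mul_collapse (f c r c' t : A) :
  c * f * (c' * f * t) = 0 -> c * r * c' * f * t = 0.
Proof.
move=> h; apply: red.
have e0 : c * ((r * c') * (f * (c' * f * t))) = 0.
  have /(reduced_mul_insert (r * c')) : c * (f * (c' * f * t)) = 0.
    by rewrite mulrA.
  by rewrite !mulrA.
have /(reduced_mul_insert (t * c * r)) : (c * r * c' * f) * (c' * f * t) = 0.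
  by move: e0; rewrite !mulrA.
by rewrite !mulrA.
Qed.

End Reduced.

(** * Prime ideals of a noncommutative ring *)

Section PrimeIdeals.
Variable A : pzRingType.

(** Instead of the ideals generated by a and b, the proof uses the larger
    ideals I of all u with u A b in P and J of all v with I A v in P, for which
    I J lies in P by construction. *)
Lemma prime_mem_mul (P : set A) (a b : A) : is_prime_ideal P ->
  (forall r, P (a * r * b)) -> P a \/ P b.
Proof.
move=> prP arb; have idP := prime_ideal prP.
pose I := [set u : A | forall r, P (u * r * b)].
pose J := [set v : A | forall u r, I u -> P (u * r * v)].
have idI : is_ideal I.
  split=> [r|u v Iu Iv r|c u Iu r|u c Iu r].
  - by rewrite !mul0r; apply: ideal0.
  - by rewrite !mulrDl; apply: idealD.
  - by rewrite -!mulrA; apply: idealMl => //; rewrite mulrA.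
  - by rewrite -(mulrA u); apply: Iu.
have idJ : is_ideal J.
  split=> [u r Iu|v w Jv Jw u r Iu|c v Jv u r Iu|v c Jv u r Iu].
  - by rewrite mulr0; apply: ideal0.
  - by rewrite mulrDr; apply: idealD => //; [apply: Jv|apply: Jw].
  - by rewrite mulrA -(mulrA u); apply: Jv.
  - by rewrite mulrA; apply: Defs.idealMr => //; apply: Jv.
have [|IP|JP] := prime_mul prP idI idJ.
- by move=> u v Iu Jv; rewrite -(mulr1 u); apply: Jv.
- by left; apply: IP.
- by right; apply: JP => u r Iu; apply: Iu.
Qed.

Lemma prime_notin1 (P : set A) : is_prime_ideal P -> ~ P 1.
Proof.
move=> prP P1; apply: (prime_proper prP); apply/seteqP; split=> // a _.
by rewrite -(mulr1 a); apply: idealMl => //; exact: prime_ideal.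
Qed.

(** The classical argument: an ideal maximal among those avoiding a
    multiplicative set is prime. *)
Lemma prime_avoiding (S : set A) :
  S 1 -> ~ S 0 -> (forall s t, S s -> S t -> S (s * t)) ->
  exists2 P : set A, is_prime_ideal P & forall s, S s -> ~ P s.
Proof.
move=> S1 S0 SM.
(* Membership of 0 is not part of this predicate, so that it holds for the
   empty set, which is the union of the empty chain. *)
pose good (Q : set A) := [/\ forall a b, Q a -> Q b -> Q (a + b),
  forall a b, Q b -> Q (a * b), forall a b, Q a -> Q (a * b)
  & forall s, S s -> ~ Q s].
have [F goodF totF|Q [[QD Ql Qr QS] Qmax]] := @Zorn_bigcup A good.
  split.
  - move=> a b [X FX Xa] [Y FY Yb].
    by have [XY|YX] := totF X Y FX FY; [exists Y|exists X] => //;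
      [have [D _ _ _] := goodF _ FY|have [D _ _ _] := goodF _ FX];
      apply: D => //; [apply: XY|apply: YX].
  - by move=> a b [X FX Xb]; exists X => //; have [_ + _ _] := goodF _ FX; apply.
  - by move=> a b [X FX Xb]; exists X => //; have [_ _ + _] := goodF _ FX; apply.
  - by move=> s Ss [X FX]; have [_ _ _ ] := goodF _ FX; apply.
have Q0 : Q 0.
  have [[q Qq]|Qn] := pselect (exists q, Q q).
    by rewrite -(mul0r q); apply: Ql.
  case: (Qmax [set 0]).
    split=> [q Qq|]; first by case: Qn; exists q.
    by move/(_ 0 erefl) => Q0; apply: Qn; exists 0.
  split=> [a b -> ->|a b ->|a b ->|s Ss /= s0] //=.
  - by rewrite addr0.
  - by rewrite mulr0.
  - by rewrite mul0r.
  - by rewrite s0 in Ss.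
have meets I : is_ideal I -> ~ I `<=` Q ->
    exists q i, [/\ Q q, I i & S (q + i)].
  move=> idI IQ; apply: contrapT => nm.
  apply: (Qmax [set y | exists q i, [/\ Q q, I i & y = q + i]]).
    split=> [q Qq|sub].
      by exists q, 0; split; [|exact: ideal0|rewrite addr0].
    apply: IQ => i Ii; apply: sub; exists 0, i; split => //; by rewrite add0r.
  split=> [_ _ [q [i [Qq Ii ->]]] [q' [i' [Qq' Ii' ->]]]|a _ [q [i [Qq Ii ->]]]|
      _ a [q [i [Qq Ii ->]]]|s Ss [q [i [Qq Ii es]]]].
  - exists (q + q'), (i + i'); rewrite addrACA.
    by split; [apply: QD|apply: idealD|].
  - exists (a * q), (a * i); rewrite mulrDr.
    by split; [apply: Ql|apply: idealMl|].
  - exists (q * a), (i * a); rewrite mulrDl.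
    by split; [apply: Qr|apply: Defs.idealMr|].
  - by apply: nm; exists q, i; rewrite -es.
exists Q => //; split; first by split.
- by move=> QT; apply: (QS 1) => //; rewrite QT.
- move=> I J idI idJ IJ; apply: contrapT => /not_orP[/(meets I idI)].
  move=> [q [i [Qq Ii Sqi]]] /(meets J idJ) [q' [j [Qq' Jj Sqj]]].
  apply: (QS _ (SM _ _ Sqi Sqj)); rewrite mulrDr !mulrDl -addrA.
  apply: (QD); first exact: Ql.
  by apply: (QD); [exact: Ql|apply: QD; [exact: Qr|exact: IJ]].
Qed.

End PrimeIdeals.

(** * Minimal primes and T1 spectra of reduced rings *)

Section ReducedT1.
Variable A : pzRingType.
Hypothesis red : reduced A.

Inductive mul_gen (P : set A) (f : A) : A -> Prop :=
| mul_gen_notin s : ~ P s -> mul_gen P f s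
| mul_gen_elt : mul_gen P f f
| mul_gen_mul s t : mul_gen P f s -> mul_gen P f t -> mul_gen P f (s * t).

(** Every product of copies of f and of elements outside P is controlled by a
    single c outside P: the factors outside P can be merged into one by
    primality, and all the copies of f into one by reducedness. *)
Lemma prime_mul_gen (P : set A) (f s : A) : is_prime_ideal P ->
  mul_gen P f s ->
  exists2 c, ~ P c & forall t, s * t = 0 -> c * f * t = 0.
Proof.
move=> prP; elim=> {s} [s nPs||s t _ [c nPc cP] _ [c' nPc' c'P]].
- by exists s => // t st0; apply: reduced_mul_insert.
- by exists 1 => [|t ft]; [exact: prime_notin1|rewrite mul1r].
have [r nr] : exists r, ~ P (c * r * c').
  apply: contrapT => /forallNP h; have [|//|//] := @prime_mem_mul A P c c' prP.
  by move=> r; apply: contrapT; apply: h.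
exists (c * r * c') => // u stu0; apply: reduced_mul_collapse => //.
have /cP h : s * (t * u) = 0 by rewrite mulrA.
have h1 : t * (u * (c * f)) = 0.
  by rewrite mulrA; apply: reduced_mul_swap => //; rewrite -mulrA.
have := c'P _ h1; rewrite mulrA => /(reduced_mul_swap red); rewrite mulrA.
by rewrite -!mulrA.
Qed.

(** If c f <> 0 for every c outside P, the multiplicative set generated by f
    and the complement of P avoids 0, and a prime avoiding it is contained in P
    but does not contain f. *)
Lemma minimal_prime_ann (P : set A) (f : A) : is_prime_ideal P ->
  (forall Q : set A, is_prime_ideal Q -> Q `<=` P -> Q = P) ->
  P f -> exists2 s, ~ P s & s * f = 0.
Proof.
move=> prP minP Pf; apply: contrapT => nann.
have [||s t|Q prQ Qavoid] := @prime_avoiding A (mul_gen P f).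
- by apply: mul_gen_notin; exact: prime_notin1.
- move=> /(prime_mul_gen prP)[c nPc /(_ 1)]; rewrite mul0r mulr1 => /(_ erefl).
  by move=> cf; apply: nann; exists c.
- exact: mul_gen_mul.
have QP : Q `<=` P.
  move=> q Qq; apply: contrapT => nPq; apply: (Qavoid q) => //.
  exact: mul_gen_notin.
by apply: (Qavoid f); [exact: mul_gen_elt|rewrite (minP Q)].
Qed.

Lemma accessible_Spec_incl (P Q : Spec A) : accessible_space (Spec A) ->
  spec_set Q `<=` spec_set P -> Q = P.
Proof.
move=> T1 QP; apply: contrapT => /eqP; rewrite eq_sym => /T1 [U []].
rewrite open_specE => -[I idI ->]; rewrite !inE /= => nIP; apply => IQ.
by apply: nIP => a /IQ /QP.
Qed.

(** The complement of W(f) is W(I), where I is the annihilator of f. *)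
Lemma reduced_accessible_closed_specW (f : A) :
  accessible_space (Spec A) -> closed (specW [set f]).
Proof.
move=> T1; rewrite -openC open_specE; exists [set s | s * f = 0].
  split=> [|a b af bf|a b bf|a b af] /=.
  - exact: mul0r.
  - by rewrite mulrDl af bf addr0.
  - by rewrite -mulrA bf mulr0.
  - exact: reduced_mul_insert.
apply/seteqP; split=> P /=.
  move=> /contrapT fP sub.
  have [||s nPs sf] := @minimal_prime_ann (spec_set P) f (spec_prime P).
  - by move=> Q prQ; move/(accessible_Spec_incl (Q := MkSpec prQ) T1) => <-.
  - exact: (fP f erefl).
  - by apply: nPs; apply: sub.
move=> nsub fP; apply: nsub => s /= sf; apply: contrapT => nPs; apply: fP => _ ->.
have [|//|//] := @prime_mem_mul A _ s f (spec_prime P).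
move=> r; rewrite reduced_mul_insert //; exact: ideal0 (prime_ideal (spec_prime P)).
Qed.

End ReducedT1.

(** * Separation in spectra with a clopen basis *)

Section ClopenBase.
Variable A : pzRingType.

Lemma open_specW1 (f : A) : open (specW [set f]).
Proof.
rewrite open_specE; exists [set a | forall J, is_ideal J -> J f -> J a].
  split=> [J idJ _|a b Ia Ib J idJ Jf|a b Ib J idJ Jf|a b Ia J idJ Jf].
  - exact: ideal0.
  - by apply: idealD => //; [apply: Ia|apply: Ib].
  - by apply: idealMl => //; apply: Ib.
  - by apply: Defs.idealMr => //; apply: Ia.
apply/seteqP; split=> P /= nf sub; apply: nf.
  by move=> _ ->; apply: sub => J _.
by move=> a; apply; [exact: prime_ideal (spec_prime P)|apply: sub].
Qed.

Lemma specW1_basis (U : set (Spec A)) (P : Spec A) : open U -> U P ->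
  exists2 f, specW [set f] P & specW [set f] `<=` U.
Proof.
rewrite open_specE => -[I idI ->] /= nIP.
have [f /not_implyP [If nPf]] : exists f, ~ (I f -> spec_set P f).
  by apply: contrapT => /forallNP h; apply: nIP => a; apply: contrapT; apply: h.
exists f; first by move/(_ f erefl).
by move=> Q /= nQf sub; apply: nQf => _ ->; apply: sub.
Qed.

Lemma specW1_separates (P Q : Spec A) : P != Q ->
  exists f, specW [set f] P <> specW [set f] Q.
Proof.
move=> /eqP PQ; apply: contrapT => /forallNP h; apply: PQ.
have {h}h f : specW [set f] P = specW [set f] Q by apply: contrapT; apply: h.
have e : spec_set P = spec_set Q.
  apply/seteqP; split=> f Pf; apply: contrapT => nf.
    have : specW [set f] Q by move/(_ f erefl).
    by rewrite -h; apply => _ ->.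
  have : specW [set f] P by move/(_ f erefl).
  by rewrite h; apply => _ ->.
case: P Q e {h} => P prP [Q prQ] /= e; case: _ / e in prQ *.
by congr MkSpec; apply: Prop_irrelevance.
Qed.

Hypothesis clW : forall f : A, closed (specW [set f]).

Lemma closed_specW_hausdorff : hausdorff_space (Spec A).
Proof.
rewrite open_hausdorff => P Q /specW1_separates [f].
have [Pf Qf|nPf Qf] := pselect (specW [set f] P).
  exists (specW [set f], ~` specW [set f]) => /=.
    split; rewrite inE //= => Q'; apply: Qf.
    by apply/propext; split.
  split; [exact: open_specW1|by rewrite openC|by rewrite setICr].
exists (~` specW [set f], specW [set f]) => /=.
  split; rewrite inE //=.
  by apply: contrapT => nQ; apply: Qf; apply/propext; split.
by split; [by rewrite openC|exact: open_specW1|rewrite setICl].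
Qed.

End ClopenBase.

(** The separating uniformity is pulled back from the discrete two-point space
    along the indicator function of U, which is continuous as U is clopen. *)
Lemma clopen_uniform_separator (T : topologicalType) (U B C : set T) :
  clopen U -> B `<=` U -> C `<=` ~` U -> uniform_separator B C.
Proof.
move=> [oU cU] BU CU.
pose f : T -> bool := fun x => `[< U x >].
pose T' : uniformType := initial_topology f.
exists (Uniform.class T'), [set xy | f xy.1 = f xy.2]; split.
- exists [set xy : bool * bool | xy.1 = xy.2] => //.
  by move=> ? /= [w _ <-].
- rewrite -subset0 => -[b c] [[/= /BU Ub /CU nUc]] /=.
  by rewrite /f asboolT // asboolF.
- move=> x V [W [[W' _ <-]] /= W'x sub].
  have : open (f @^-1` W').
    have [tW|tW] := pselect (W' true); have [fW|fW] := pselect (W' false).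
    - rewrite (_ : _ @^-1` _ = setT); first exact: openT.
      by apply/seteqP; split=> // y _ /=; case: (f y).
    - rewrite (_ : _ @^-1` _ = U) //; apply/seteqP; split=> y /=.
        by case E: (f y) => //= _; apply/asboolP.
      by move=> Uy; rewrite /f asboolT.
    - rewrite (_ : _ @^-1` _ = ~` U); first by rewrite openC.
      apply/seteqP; split=> y /=.
        by case E: (f y) => // _ Uy; move: E; rewrite /f asboolT.
      by move=> Uy; rewrite /f asboolF.
    - rewrite (_ : _ @^-1` _ = set0); first exact: open0.
      by apply/seteqP; split=> // y /=; case: (f y).
  rewrite openE => /(_ x W'x); apply: filterS; exact: sub.
Qed.

Lemma closed_specW_completely_regular (A : pzRingType) :
  (forall f : A, closed (specW [set f])) -> completely_regular_space (Spec A).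
Proof.
move=> clW P B clB nBP.
have [||f Pf sub] := @specW1_basis A (~` B) P.
- by rewrite openC.
- by [].
apply: (@clopen_uniform_separator _ (specW [set f])) => //.
- split; [exact: open_specW1|exact: clW].
- by move=> _ ->.
- by move=> Q BQ /sub.
Qed.

(** * The coefficient ring *)

Section Coefficients.
Variables (R : pzRingType) (n : nat) (sigma : 'I_n -> {rmorphism R -> R}).

Definition multi1 (i : 'I_n) : multi_index n := [ffun j => (j == i) : nat].

Lemma sigma_pow_multi1 i (r : R) : sigma_pow sigma (multi1 i) r = sigma i r.
Proof.
have h (s : seq 'I_n) : uniq s ->
    (\big[(fun f g : R -> R => f \o g)/idfun]_(k <- s)
       iter (multi1 i k) (sigma k)) r = if i \in s then sigma i r else r.
  elim: s => [|k s IHs] /=; first by rewrite big_nil.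
  move=> /andP[ks /IHs]; rewrite big_cons /= inE ffunE => ->.
  by have [ki|ki] := eqVneq k i; rewrite /= -?ki ?(negPf ks) ?eqxx.
by rewrite /sigma_pow h ?index_enum_uniq // mem_index_enum.
Qed.

Hypothesis semicomm : Sigma_semicommutative sigma.

Lemma semicommutative_mul i (a b r : R) : a * b = 0 -> a * r * sigma i b = 0.
Proof.
move=> ab0; rewrite -sigma_pow_multi1; apply: semicomm => //.
by move=> /ffunP /(_ i); rewrite !ffunE eqxx.
Qed.

(** Both e (1 - e) = 0 and (1 - e) e = 0 are exploited: the first gives
    e r = e r sigma_i(e), the second r sigma_i(e) = e r sigma_i(e). *)
Lemma semicommutative_idem i (e r : R) : e * e = e ->
  sigma i e = e /\ e * r = r * e.
Proof.
move=> ee.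
have e1 : e * (1 - e) = 0 by rewrite mulrBr mulr1 ee subrr.
have e2 : (1 - e) * e = 0 by rewrite mulrBl mul1r ee subrr.
have h1 s : e * s = e * s * sigma i e.
  have := semicommutative_mul i s e1.
  by rewrite rmorphB rmorph1 mulrBr mulr1 => /eqP; rewrite subr_eq0 => /eqP.
have h2 s : s * sigma i e = e * s * sigma i e.
  have := semicommutative_mul i s e2.
  by rewrite mulrBl mul1r mulrBl => /eqP; rewrite subr_eq0 => /eqP.
have se : sigma i e = e.
  by have := h1 1; rewrite -h2 mulr1 mul1r => <-.
by split=> //; rewrite h1 -h2 se.
Qed.

Hypothesis baer : Baer R.
Hypothesis sigma_inj : forall i, injective (sigma i).

Lemma Baer_annP (a : R) : exists2 e, e * e = e &
  a * e = 0 /\ forall b, a * b = 0 -> e * b = b.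
Proof.
have [|e ee annE] := baer (S := [set a]); first by exists a.
exists e => //; split=> [|b ab].
  have : right_annihilator [set a] e by rewrite annE; exists 1; rewrite ?mulr1.
  exact.
have : right_annihilator [set a] b by move=> _ ->.
by rewrite annE => -[t _ <-]; rewrite mulrA ee.
Qed.

(** The annihilator of a is e R with e central, so a * a = 0 gives
    a = e a = a e = 0. *)
Lemma semicommutative_Baer_reduced : (0 < n)%N -> reduced R.
Proof.
case: n sigma semicomm semicommutative_idem => // m s _ idem _ a aa.
have [e ee [ae eP]] := Baer_annP a.
by rewrite -(eP a aa); have [_ ->] := idem ord0 e a ee.
Qed.

(** If the annihilator of a is e R, then a sigma_i(b) = 0 says
    sigma_i(b) = e sigma_i(b) = sigma_i(e b); injectivity gives b = e b, whence
    a b = a e b = 0. *)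
Lemma semicommutative_Baer_compatible i (a b : R) :
  a * sigma i b = 0 -> a * b = 0.
Proof.
have [e ee [ae eP]] := Baer_annP a.
move=> /eP; have [<- _] := semicommutative_idem i 0 ee.
by rewrite -rmorphM => /sigma_inj <-; rewrite mulrA ae mul0r.
Qed.

End Coefficients.

(** * Multi-indices *)

Section MultiIndex.
Variable n : nat.
Implicit Types (al be ga : multi_index n) (i j k : 'I_n).

Definition madd al be : multi_index n := [ffun i => (al i + be i)%N].
Definition mdeg al := (\sum_i al i)%N.

Lemma mdegD al be : mdeg (madd al be) = (mdeg al + mdeg be)%N.
Proof. by rewrite -big_split; apply: eq_bigr => i _; rewrite ffunE. Qed.

Lemma mdeg0 : mdeg (multi0 n) = 0%N.
Proof. by rewrite /mdeg big1 // => i _; rewrite ffunE. Qed.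

Lemma mdeg1 i : mdeg (multi1 i) = 1%N.
Proof.
rewrite /mdeg (bigD1 i) //= ffunE eqxx big1 // => j ji.
by rewrite ffunE (negPf ji).
Qed.

Lemma maddA al be ga : madd al (madd be ga) = madd (madd al be) ga.
Proof. by apply/ffunP => i; rewrite !ffunE addnA. Qed.

Lemma maddC al be : madd al be = madd be al.
Proof. by apply/ffunP => i; rewrite !ffunE addnC. Qed.

Lemma madd0 al : madd (multi0 n) al = al.
Proof. by apply/ffunP => i; rewrite !ffunE. Qed.

(** Peeling off the first variable of a monomial, which is the one that can be
    split off on the left without commuting anything. *)
Lemma multi_index_first al k : al k != 0%N ->
  exists j be, [/\ (j <= k)%N, al = madd (multi1 j) be
    & forall l : 'I_n, (l < j)%N -> be l = 0%N].
Proof.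
move=> alk; have [j alj jmin] := @arg_minnP _ k (fun j => al j != 0%N) val alk.
exists j, [ffun l => (al l - (l == j))%N]; split; first exact: jmin.
  apply/ffunP => l; rewrite !ffunE; case: eqP => [->|_].
    by rewrite subnKC // lt0n.
  by rewrite subn0.
move=> l lj; rewrite ffunE; have [->//|] := eqVneq (al l) 0%N.
by move=> /jmin; rewrite leqNgt lj.
Qed.

(** Breaks ties between multi-indices of equal degree: it is strictly convex,
    so a multi-index where it is maximal is not the midpoint of two others. *)
Definition msqn al := (\sum_i al i ^ 2)%N.

Lemma sqn_midpoint (a b c : nat) : (a + b = c + c)%N ->
  (2 * c ^ 2 <= a ^ 2 + b ^ 2 ?= iff (a == b))%N.
Proof.
rewrite -!mulnn; wlog ab : a b / (a <= b)%N => [wlg|].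
  move=> abc; have [/wlg|/ltnW /wlg h] := leqP a b; first exact.
  by rewrite eq_sym (addnC (a * a)%N); apply: h; rewrite addnC.
move=> abc; have [d cE] : exists d, c = (a + d)%N by exists (c - a)%N; lia.
have -> : b = (a + 2 * d)%N by lia.
rewrite {}cE.
have -> : (a * a + (a + 2 * d) * (a + 2 * d) =
  2 * ((a + d) * (a + d)) + 2 * (d * d))%N by lia.
split; first exact: leq_addr.
rewrite -[X in X == _]addn0 -[X in _ = (X == _)]addn0 !eqn_add2l.
by rewrite !(eq_sym 0%N) !muln_eq0 /= orbb.
Qed.

(** An element of a finite set that maximizes first the degree and then the sum
    of squares is an extreme point: summing
    2 c^2 <= a^2 + b^2 (for a + b = c + c) over the coordinates, maximality
    forces equality everywhere. *)
Lemma madd_extremal al be ga :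
  madd al be = madd ga ga ->
  (mdeg al <= mdeg ga)%N -> (mdeg be <= mdeg ga)%N ->
  (mdeg al = mdeg ga -> (msqn al <= msqn ga)%N) ->
  (mdeg be = mdeg ga -> (msqn be <= msqn ga)%N) ->
  al = ga /\ be = ga.
Proof.
move=> e dal dbe sal sbe.
have edeg : (mdeg al + mdeg be = mdeg ga + mdeg ga)%N by rewrite -!mdegD e.
have {}sal : (msqn al <= msqn ga)%N by apply: sal; lia.
have {}sbe : (msqn be <= msqn ga)%N by apply: sbe; lia.
have ei i : (al i + be i = ga i + ga i)%N.
  by move/ffunP: e => /(_ i); rewrite !ffunE.
have [sum_le eqs] : (\sum_i 2 * ga i ^ 2 <= \sum_i (al i ^ 2 + be i ^ 2)
    ?= iff [forall i, al i == be i])%N.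
  by apply: leqif_sum => i _; apply: sqn_midpoint.
have : (\sum_i 2 * ga i ^ 2 == \sum_i (al i ^ 2 + be i ^ 2))%N.
  rewrite eqn_leq sum_le big_split -big_distrr /=.
  by rewrite -/(msqn al) -/(msqn be) -/(msqn ga); lia.
rewrite eqs => /forallP albe.
split; apply/ffunP => i; move: (ei i) (eqP (albe i)).
  by move: (al i) (be i) (ga i) => a b c; lia.
by move: (al i) (be i) (ga i) => a b c; lia.
Qed.

End MultiIndex.

Lemma seq_argmax (T : eqType) (phi : T -> nat) (s : seq T) : s <> [::] ->
  exists2 a, a \in s & forall b, b \in s -> (phi b <= phi a)%N.
Proof.
elim: s => // a s IHs _; have [->|/eqP /IHs[b bs bmax]] := eqVneq s [::].
  by exists a; rewrite ?mem_head // => b; rewrite inE => /eqP ->.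
have [ab|ba] := leqP (phi a) (phi b).
  exists b; rewrite ?inE ?bs ?orbT // => c; rewrite inE => /orP[/eqP ->//|].
  exact: bmax.
exists a; rewrite ?mem_head // => c; rewrite inE => /orP[/eqP ->//|/bmax h].
exact: leq_trans h (ltnW ba).
Qed.

(** * Leading terms in skew PBW extensions *)

Section SkewPBW.
Variables (R A : pzRingType) (iota : {rmorphism R -> A}) (n : nat).
Variables (x : 'I_n -> A) (pbw : is_skew_PBW iota x).
Variables (sigma : 'I_n -> {rmorphism R -> R}).
Variables (delta : 'I_n -> {additive R -> R}).
Hypothesis assoc : skew_PBW_associated iota x sigma delta.
Hypothesis redR : reduced R.
Hypothesis compat : forall i a b, a * sigma i b = 0 -> a * b = 0.

Local Notation M := (monomial x).
Implicit Types (al be ga : multi_index n) (i j k : 'I_n) (r u v : R).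
Implicit Types (D : multi_index n -> Prop).

(** The left R-span of the monomials with exponent in D; the inductive form
    turns each closure property into a one-line induction. *)
Inductive mspan D : A -> Prop :=
| mspan0 : mspan D 0
| mspan_cons r al a : D al -> mspan D a -> mspan D (iota r * M al + a).

Lemma mspanD D a b : mspan D a -> mspan D b -> mspan D (a + b).
Proof.
elim=> [|r al c Dal _ IH] Db; first by rewrite add0r.
by rewrite -addrA; apply: mspan_cons => //; apply: IH.
Qed.

Lemma mspanZ D r a : mspan D a -> mspan D (iota r * a).
Proof.
elim=> [|r' al c Dal _ IH]; first by rewrite mulr0; apply: mspan0.
by rewrite mulrDr mulrA -rmorphM; apply: mspan_cons.
Qed.

Lemma mspanN D a : mspan D a -> mspan D (- a).
Proof. by move=> /(mspanZ (-1)); rewrite rmorphN rmorph1 mulN1r. Qed.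

Lemma mspan_sum D (I : Type) (s : seq I) (F : I -> A) :
  (forall t, mspan D (F t)) -> mspan D (\sum_(i <- s) F i).
Proof.
move=> DF; elim: s => [|t s IHs]; first by rewrite big_nil; apply: mspan0.
by rewrite big_cons; apply: mspanD.
Qed.

Lemma mspanM D r al : D al -> mspan D (iota r * M al).
Proof.
by move=> Dal; rewrite -[_ * _]addr0; apply: mspan_cons => //; apply: mspan0.
Qed.

Lemma mspan_sub D D' a : (forall al, D al -> D' al) -> mspan D a -> mspan D' a.
Proof.
move=> sub; elim=> [|r al c /sub Dal _ IH]; first exact: mspan0.
exact: mspan_cons.
Qed.

Lemma mspan_normal D a : mspan D a -> exists (s : seq (multi_index n)) c,
  [/\ uniq s, a = \sum_(al <- s) iota (c al) * M al
    & forall al, al \in s -> D al].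
Proof.
elim=> [|r al b Dal _ [s [c [us -> sD]]]].
  by exists [::], (fun=> 0); rewrite big_nil.
pose c' be := if be == al then r + (if al \in s then c al else 0) else c be.
have c'E (t : seq (multi_index n)) : al \notin t ->
    \sum_(be <- t) iota (c' be) * M be = \sum_(be <- t) iota (c be) * M be.
  move=> alt; apply: eq_big_seq => be bet; rewrite /c'; case: eqP => // e.
  by rewrite -e bet in alt.
have [als|als] := boolP (al \in s); last first.
  exists (al :: s), c'; split=> [||be]; first by rewrite /= als.
    by rewrite big_cons c'E // /c' eqxx (negPf als) addr0.
  by rewrite inE => /orP[/eqP ->//|]; apply: sD.
exists s, c'; split=> //; rewrite !(perm_big _ (perm_to_rem als)) /= !big_cons.
rewrite c'E ?mem_rem_uniq ?inE ?eqxx // /c' eqxx als.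
by rewrite rmorphD mulrDl addrA.
Qed.

Lemma mspan_free D r ga : ~ D ga -> mspan D (iota r * M ga) -> r = 0.
Proof.
move=> nD /mspan_normal[s [c [us e sD]]].
have gas : ga \notin s by apply/negP => /sD.
pose c' be := if be == ga then - r else c be.
have := skew_PBW_free pbw (s := ga :: s) (c := c').
rewrite /= gas us => /(_ isT); rewrite big_cons /c' eqxx.
have -> : \sum_(al <- s) iota (if al == ga then - r else c al) * M al =
    iota r * M ga.
  rewrite e; apply: eq_big_seq => be bes; case: eqP => // ebe.
  by rewrite -ebe bes in gas.
rewrite rmorphN mulNr addNr => /(_ erefl ga); rewrite inE eqxx => /(_ isT).
by move/eqP; rewrite oppr_eq0 => /eqP.
Qed.

Lemma mspanT a : mspan (fun=> True) a.
Proof.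
have [s [c ->]] := skew_PBW_span pbw a.
by apply: mspan_sum => al; apply: mspanM.
Qed.

Local Notation degspan d := (mspan (fun al => (mdeg al < d)%N)).

Lemma degspan_le d d' a : (d <= d')%N -> degspan d a -> degspan d' a.
Proof. by move=> dd'; apply: mspan_sub => al h; apply: leq_trans h dd'. Qed.

Lemma monomial0 : M (multi0 n) = 1.
Proof. by rewrite /monomial big1 // => i _; rewrite ffunE expr0. Qed.

(** As x i ^+ al i is the first nontrivial factor of the ordered monomial, one
    more factor x i on the left is absorbed without any commutation. *)
Lemma monomial_shift i al : (forall k, (k < i)%N -> al k = 0%N) ->
  x i * M al = M (madd (multi1 i) al).
Proof.
move=> al0; have enumE be : M be = \prod_(k <- enum 'I_n) x k ^+ be k.
  by rewrite enumT /monomial [index_enum _]unlock.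
rewrite !enumE.
have: i \in enum 'I_n by rewrite mem_enum.
have idx k : index k (enum 'I_n) = k by rewrite index_enum_ord.
have := enum_uniq 'I_n; move: idx; move: (enum _) => s idx us si.
move: si idx us => /splitPr[s1 s2] idx.
rewrite cat_uniq /= => /and3P[_ /norP[is1 _] /andP[is2 _]].
have s1P k : k \in s1 -> (k < i)%N.
  move=> ks1; rewrite -(idx k) -(idx i) !index_cat ks1 (negPf is1) /= eqxx.
  by rewrite addn0 index_mem.
have prod1 be : (forall k, (k < i)%N -> be k = 0%N) ->
    \prod_(k <- s1) x k ^+ be k = 1.
  by move=> be0; rewrite big1_seq // => k /andP[_ /s1P/be0->].
rewrite !big_cat !big_cons /= !prod1 // ?mul1r.
  rewrite mulrA -exprS !ffunE eqxx; congr (_ * _).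
  apply: eq_big_seq => k ks2; rewrite !ffunE; case: eqP => // e.
  by rewrite -e ks2 in is2.
by move=> k ki; rewrite !ffunE al0 // (ltn_eqF ki : (k == i) = false).
Qed.

Lemma monomial1 i : M (multi1 i) = x i.
Proof.
rewrite -[RHS]mulr1 -monomial0 monomial_shift; last by move=> k _; rewrite ffunE.
by rewrite maddC madd0.
Qed.

Lemma degspan_affine r (f : 'I_n -> R) :
  degspan 2 (iota r + \sum_k iota (f k) * x k).
Proof.
apply: mspanD.
  by rewrite -[iota r]mulr1 -monomial0; apply: mspanM; rewrite mdeg0.
by apply: mspan_sum => k; rewrite -monomial1; apply: mspanM; rewrite mdeg1.
Qed.

Lemma reduced_left_inv u v : v * u = 1 -> u * v = 1.
Proof.
move=> vu; apply/eqP; rewrite eq_sym -subr_eq0; apply/eqP.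
have h : (1 - u * v) * u = 0 by rewrite mulrBl mul1r -mulrA vu mulr1 subrr.
by rewrite -[LHS]mul1r -{1}vu -mulrA (reduced_mul_swap redR h) mulr0.
Qed.

(** The structure constants d_ij are only assumed to be nonzero.  Writing
    x_i x_j in terms of x_j x_i and back, freeness of the monomials gives
    d_ji d_ij = 1, hence d_ij is invertible since R is reduced. *)
Lemma skew_PBW_comm_inv i j : (j < i)%N ->
  exists d v (r0 : R) (r : 'I_n -> R),
  d * v = 1 /\
  x i * x j = iota d * (x j * x i) + (iota r0 + \sum_k iota (r k) * x k).
Proof.
move=> ji.
have [d _ [r0 [r e]]] := skew_PBW_comm pbw j i.
have [d' _ [r0' [r' e']]] := skew_PBW_comm pbw i j.
exists d, d', r0, r.
have {}e :
    x i * x j = iota d * (x j * x i) + (iota r0 + \sum_k iota (r k) * x k).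
  by rewrite -e mulrA addrC subrK.
have {}e' :
    x j * x i = iota d' * (x i * x j) + (iota r0' + \sum_k iota (r' k) * x k).
  by rewrite -e' mulrA addrC subrK.
split=> //; apply: reduced_left_inv; apply/eqP.
rewrite eq_sym -subr_eq0; apply/eqP.
have nf : ~ (mdeg (madd (multi1 j) (multi1 i)) < 2)%N.
  by rewrite mdegD !mdeg1.
apply: (@mspan_free (fun al => (mdeg al < 2)%N) _ _ nf).
have -> : iota (1 - d' * d) * M (madd (multi1 j) (multi1 i)) =
    iota d' * (iota r0 + \sum_k iota (r k) * x k) +
    (iota r0' + \sum_k iota (r' k) * x k).
  rewrite -monomial_shift ?monomial1; last first.
    move=> k kj; rewrite ffunE.
    by rewrite (ltn_eqF (ltn_trans kj ji) : (k == i) = false).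
  rewrite rmorphB rmorph1 mulrBl mul1r {1}e' e mulrDr rmorphM -!mulrA.
  by rewrite addrAC [X in X + _ = _]addrAC subrr add0r.
by apply: mspanD; [apply: mspanZ|]; apply: degspan_affine.
Qed.

Definition shift_lead al i := exists u v g,
  [/\ u * v = 1, degspan (mdeg al).+1 g &
   x i * M al = iota u * M (madd (multi1 i) al) + g].

Lemma mul_var_term i r a :
  x i * (iota r * a) = iota (sigma i r) * (x i * a) + iota (delta i r) * a.
Proof. by have [_ _ e] := assoc i; rewrite mulrA e mulrDl mulrA. Qed.

(** The assumption is restricted to degrees less than d because the lemma is
    used inside the induction on the degree that proves [shift_lead]. *)
Lemma mul_var_degspan_aux i d a :
  (forall al, (mdeg al < d)%N -> shift_lead al i) ->
  degspan d a -> degspan d.+1 (x i * a).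
Proof.
move=> H; elim=> [|r al b ald _ IH]; first by rewrite mulr0; apply: mspan0.
rewrite mulrDr; apply: mspanD => //; rewrite mul_var_term.
have [u [v [g [_ gd ->]]]] := H _ ald.
apply: mspanD; last by apply: mspanM; apply: ltnW.
apply: mspanZ; apply: mspanD; last exact: degspan_le (leqW ald) gd.
by apply: mspanM; rewrite mdegD mdeg1.
Qed.

(** Induction on the degree.  If x i is not after the first variable x j of the
    monomial, [monomial_shift] applies; otherwise x i is moved across x j, and
    the terms created by the commutation relation and by delta have lower
    degree. *)
Lemma shift_leadP al i : shift_lead al i.
Proof.
have [m] := ubnP (mdeg al); elim: m al i => // m IHm al i.
rewrite ltnS => alm.
have [/forallP al0|] := boolP [forall k : 'I_n, (k < i)%N ==> (al k == 0%N)].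
  exists 1, 1, 0; split; [by rewrite mulr1|exact: mspan0|].
  rewrite rmorph1 mul1r addr0; apply: monomial_shift => k ki.
  by apply/eqP; apply: (implyP (al0 k)).
rewrite negb_forall => /existsP[k]; rewrite negb_imply => /andP[ki alk].
have [j [be [jk alE be0]]] := multi_index_first alk.
have ji : (j < i)%N := leq_ltn_trans jk ki.
have dal : mdeg al = (mdeg be).+1 by rewrite alE mdegD mdeg1.
have dbe : (mdeg be < m)%N by rewrite -dal.
have [d [d' [r0 [r [dd' e]]]]] := skew_PBW_comm_inv ji.
have [u [v [g [uv gd eg]]]] := IHm be i dbe.
exists (d * sigma j u), (sigma j v * d').
exists (iota d * (iota (delta j u) * M (madd (multi1 i) be) + x j * g) +
   (iota r0 * M be + \sum_k iota (r k) * (x k * M be))).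
have shift_deg l b : degspan (mdeg be).+1 b -> degspan (mdeg be).+2 (x l * b).
  move=> bd; apply: mul_var_degspan_aux bd => ga gd'.
  by apply: IHm; apply: leq_ltn_trans dbe.
split.
- by rewrite mulrA -(mulrA d) -rmorphM uv rmorph1 mulr1.
- rewrite dal; apply: mspanD.
    apply: mspanZ; apply: mspanD; last exact: shift_deg.
    by apply: mspanM; rewrite mdegD mdeg1.
  apply: mspanD; first by apply: mspanM; rewrite ltnS leqnSn.
  apply: mspan_sum => l; apply: mspanZ; apply: shift_deg.
  by rewrite -[M be]mul1r -(rmorph1 iota); apply: mspanM.
have -> : M al = x j * M be by rewrite alE monomial_shift.
rewrite mulrA e mulrDl mulrDl mulr_suml.
under eq_bigr do rewrite -mulrA.
rewrite [RHS]addrA; congr (_ + _); rewrite -!mulrA eg mulrDr mul_var_term.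
rewrite monomial_shift; last first.
  move=> l lj; rewrite !ffunE be0 // addn0.
  by rewrite (ltn_eqF (ltn_trans lj ji) : (l == i) = false).
rewrite alE !maddA (maddC (multi1 i) (multi1 j)) -addrA mulrDr rmorphM.
by rewrite !mulrA.
Qed.

Lemma mul_var_degspan i d a : degspan d a -> degspan d.+1 (x i * a).
Proof. by apply: mul_var_degspan_aux => al _; apply: shift_leadP. Qed.

(** The twist tau is the composite sigma^al; only the fact that it reflects
    zero products is recorded, as this is all that leading coefficients need. *)
Lemma monomial_mul_lead al be : exists (tau : R -> R) u v,
  [/\ forall a b : R, a * tau b = 0 -> a * b = 0, u * v = 1 &
   forall r, exists2 g, degspan (mdeg al + mdeg be) g &
     M al * (iota r * M be) = iota (tau r * u) * M (madd al be) + g].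
Proof.
have [m] := ubnP (mdeg al); elim: m al => // m IHm al; rewrite ltnS => alm.
have [/forallP al0|] := boolP [forall k, al k == 0%N].
  exists id, 1, 1; split=> //; first by rewrite mulr1.
  have -> : al = multi0 n by apply/ffunP => k; rewrite ffunE; apply/eqP.
  move=> r; exists 0; first exact: mspan0.
  by rewrite monomial0 mul1r mulr1 madd0 addr0.
rewrite negb_forall => /existsP[k alk].
have [j [al' [_ alE al'0]]] := multi_index_first alk.
have dal : mdeg al = (mdeg al').+1 by rewrite alE mdegD mdeg1.
have [|tau [u [v [tauP uv H]]]] := IHm al'; first by rewrite -dal.
have [w [w' [g [ww' gd eg]]]] := shift_leadP (madd al' be) j.
exists (sigma j \o tau), (sigma j u * w), (w' * sigma j v); split=> [a b||r].
- by move=> /compat /tauP.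
- by rewrite mulrA -(mulrA (sigma j u)) ww' mulr1 -rmorphM uv rmorph1.
have [h hd eh] := H r.
exists (iota (sigma j (tau r * u)) * g + iota (delta j (tau r * u)) * M (madd al' be)
  + x j * h).
  rewrite dal addSn; apply: mspanD; last exact: mul_var_degspan.
  rewrite mdegD in gd; apply: mspanD; first exact: mspanZ.
  by apply: mspanM; rewrite mdegD.
have -> : M al = x j * M al' by rewrite alE monomial_shift.
rewrite -mulrA eh mulrDr mul_var_term eg mulrDr alE -maddA /=.
rewrite [iota _ * (iota w * _)]mulrA -(rmorphM iota).
by rewrite [sigma j (tau r) * _]mulrA -(rmorphM (sigma j)) !addrA.
Qed.

(** Induction on the size of a support s of f: the coefficient at an extremal
    exponent al of s vanishes, since no other pair of elements of s contributes
    to the monomial of exponent al + al in f * f. *)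
Lemma skew_PBW_reduced : reduced A.
Proof.
move=> f; have [s [c [us -> _]]] := mspan_normal (mspanT f).
have [m] := ubnP (size s); elim: m s us => // m IHm s us; rewrite ltnS => sm ff.
have [->|/eqP s0] := eqVneq s [::]; first by rewrite big_nil.
have [a as_ amax] := seq_argmax (@mdeg n) s0.
pose s' := [seq b <- s | mdeg b == mdeg a].
have [|al + almax] := seq_argmax (@msqn n) (s := s').
  by apply/eqP; rewrite -size_eq0 -lt0n size_filter -has_count; apply/hasP; exists a.
rewrite mem_filter => /andP[/eqP dal als].
have exP b d : b \in s -> d \in s -> madd b d = madd al al -> b = al /\ d = al.
  move=> bs ds e; apply: madd_extremal e _ _ _ _; rewrite ?dal ?amax // => h.
    by apply: almax; rewrite mem_filter bs h eqxx.
  by apply: almax; rewrite mem_filter ds h eqxx.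
pose D ga := ga <> madd al al.
have degD b d g : b \in s -> d \in s -> degspan (mdeg b + mdeg d) g -> mspan D g.
  move=> bs ds; apply: mspan_sub => ga h e; move: h; rewrite e mdegD dal.
  by rewrite ltnNge leq_add ?amax.
have pairD b d : b \in s -> d \in s -> b <> al \/ d <> al ->
    mspan D ((iota (c b) * M b) * (iota (c d) * M d)).
  move=> bs ds bd; rewrite -mulrA; apply: mspanZ.
  have [tau [u [v [_ _ H]]]] := monomial_mul_lead b d.
  have [g /(degD _ _ _ bs ds) gD ->] := H (c d).
  by apply: mspanD => //; apply: mspanM => /(exP _ _ bs ds)[ea ed]; case: bd.
have cal : c al = 0.
  have [tau [u [v [tauP uv H]]]] := monomial_mul_lead al al.
  have [g /(degD _ _ _ als als) gD eg] := H (c al).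
  apply: redR; apply: tauP.
  rewrite -[LHS]mulr1 -uv !mulrA -(mulrA _ _ u).
  suff -> : c al * (tau (c al) * u) = 0 by rewrite mul0r.
  apply: (@mspan_free D _ (madd al al)); first by move=> /(_ erefl).
  pose t := rem al s.
  have tP b : b \in t -> b \in s /\ b <> al.
    by rewrite mem_rem_uniq // inE => /andP[/eqP].
  pose h := \sum_(b <- t) iota (c b) * M b.
  have sE : \sum_(b <- s) iota (c b) * M b = iota (c al) * M al + h.
    by rewrite (perm_big _ (perm_to_rem als)) big_cons.
  have sumD (F : multi_index n -> A) : (forall b, b \in t -> mspan D (F b)) ->
      mspan D (\sum_(b <- t) F b).
    move=> HF; rewrite big_seq.
    by elim/big_ind: _ => //; [exact: mspan0|exact: mspanD].
  move: ff; rewrite sE mulrDl !mulrDr -mulrA eg mulrDr mulrA -rmorphM.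
  (* All terms of f * f but the leading one avoid the exponent al + al. *)
  move/eqP; rewrite -!addrA addr_eq0 => /eqP ->; apply: mspanN.
  apply: mspanD; first exact: mspanZ.
  apply: mspanD.
    rewrite mulr_sumr; apply: (sumD) => b /tP[bs bal].
    by apply: pairD => //; right.
  rewrite !mulr_suml; apply: mspanD; apply: (sumD) => b /tP[bs bal].
    by apply: pairD => //; left.
  rewrite mulr_sumr; apply: (sumD) => d /tP[ds _].
  by apply: pairD => //; left.
have sE : \sum_(b <- s) iota (c b) * M b = \sum_(b <- rem al s) iota (c b) * M b.
  by rewrite (perm_big _ (perm_to_rem als)) big_cons cal rmorph0 mul0r /= add0r.
rewrite sE; apply: IHm; first exact: rem_uniq.
  by rewrite size_rem //; case: (s) sm s0.
by rewrite -sE.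
Qed.

End SkewPBW.

(** * Separation properties of the prime spectrum *)

Theorem proposition5p1 (R A : pzRingType) (iota : {rmorphism R -> A})
    (n : nat) (n_gt0 : (0 < n)%N) (x : 'I_n -> A)
    (pbw : is_skew_PBW iota x)
    (sigma : 'I_n -> {rmorphism R -> R})
    (delta : 'I_n -> {additive R -> R})
    (assoc : skew_PBW_associated iota x sigma delta)
    (semicomm : Sigma_semicommutative sigma)
    (baer : Baer R) :
  [<-> forall f : A, closed (specW [set f]);
       completely_regular_space (Spec A) /\ hausdorff_space (Spec A);
       accessible_space (Spec A)].
Proof.
have sigma_inj i : injective (sigma i) by case: (assoc i).
have redR := semicommutative_Baer_reduced semicomm baer n_gt0.
have redA : reduced A.
  apply: (skew_PBW_reduced pbw assoc redR) => i a b.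
  exact: semicommutative_Baer_compatible.
tfae.
- by move=> clW; split;
    [exact: closed_specW_completely_regular|exact: closed_specW_hausdorff].
- by move=> [_ /hausdorff_accessible].
- by move=> T1 f; apply: reduced_accessible_closed_specW.
Qed.
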